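(* Let $s\ge 2$ be an integer and let $C=2(s-1)^{\frac{1}{s+1}}$. There exists $n_0=n_0(s)$ such that for every $n\ge n_0$, every balanced tripartite graph $G$ with three parts of size $n$ and minimum degree $\delta(G)\ge n+Cn^{1-\frac{1}{s(s+1)}}$ contains a copy of $K_3(s)$ as a subgraph. In particular, for all sufficiently large $n$, if $\delta(G)\ge n+2n^{\frac56}$, then $G$ contains a copy of $K_3(2)$.
   Context: A balanced tripartite graph with parts of size $n$ is a simple graph whose vertex set is the disjoint union of three sets $V_1,V_2,V_3$, each of size $n$, with no edge inside any $V_i$. $K_3(s)$ denotes the complete tripartite graph with three parts of size $s$. $\delta(G)$ is the minimum degree of $G$. *)

(* Defs.v *)
From HB Require Import structures.
From mathcomp Require Import all_boot all_order all_algebra.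
From mathcomp Require Import reals exp.

Set Implicit Arguments.
Unset Strict Implicit.
Unset Printing Implicit Defensive.

Record sgraph := SGraph {
  vertex :> finType;
  edge : rel vertex;
  edge_sym : symmetric edge;
  edge_irr : irreflexive edge }.

Definition degree (G : sgraph) (x : G) : nat := #|[set y | edge x y]|.

(* Every degree is less than #|G|, so the initial value #|G| only matters for
   the empty graph, where the minimum is 0. *)
Definition min_degree (G : sgraph) : nat := \big[minn/#|G|]_(x : G) degree x.

Definition balanced_tripartite (n : nat) (G : sgraph) : Prop :=
  exists V : 'I_3 -> {set G},
    [/\ \bigcup_(i < 3) V i = [set: G],
        forall i j, i != j -> [disjoint V i & V j],
        forall i, #|V i| = n
      & forall i (x y : G), x \in V i -> y \in V i -> ~~ edge x y].

Definition K3_edge (s : nat) : rel ('I_3 * 'I_s)%type :=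
  fun x y => x.1 != y.1.

Lemma K3_edge_sym s : symmetric (@K3_edge s).
Proof. by move=> x y; rewrite /K3_edge eq_sym. Qed.

Lemma K3_edge_irr s : irreflexive (@K3_edge s).
Proof. by move=> x; rewrite /K3_edge eqxx. Qed.

Definition K3 (s : nat) : sgraph := SGraph (@K3_edge_sym s) (@K3_edge_irr s).

(* Not necessarily an induced subgraph. *)
Definition contains_copy (G H : sgraph) : Prop :=
  exists2 f : H -> G, injective f & forall x y : H, edge x y -> edge (f x) (f y).

(* Main.v *)
Require Import Defs.
From HB Require Import structures.
From mathcomp Require Import all_boot all_order all_algebra.
From mathcomp Require Import reals exp.
From mathcomp Require Import zify lra.
Import Order.TTheory GRing.Theory Num.Theory.
Local Open Scope ring_scope.

(** Write f(x) and g(x) for the numbers of neighbours of a vertex x of V_i in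
    V_(i+1) and V_(i-1), with indices modulo 3, and let n + t be the minimum
    degree.  The proof rests on two facts.

    Supply of triangles.  If x in V_i and z in V_(i-1) are adjacent, they have
    at least f(x) + g(z) - n >= t + f(x) - f(z) common neighbours in V_(i+1).
    Take the largest level tau for which some set {x in V_i : f(x) >= tau} has
    m elements: such an x has fewer than m neighbours of higher f, so all but m
    of its neighbours in V_(i-1) share at least t common neighbours with x
    (lemmas top_level and top_level_rich).

    Demand.  Let A contain a vertices, each with d neighbours z in B such that
    the edge has g common neighbours in C.  Averaging over the s-subsets S of C
    leaves, for some S, a bipartite graph between A and B of average degree about
    d (g/|C|)^s, and the argument of Kovari, Sos and Turan finds a K_(s,s) in it
    as soon as a (d/|B|)^s (g/|C|)^(s^2) exceeds a constant (K3_of_rich).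

    Let h be much larger than t and much smaller than n.  If fewer than about t
    vertices of each class have f >= n - h, the supply at level m = h/2 gives
    about h vertices with about h rich neighbours each, because f(x) < n - h
    forces g(x) > t + h (K3_of_no_top).  Otherwise the supply at level m = t/2
    gives about t vertices x with f(x) >= n - h and about t rich neighbours z
    each (K3_of_top).  Neighbours z with g(z) >= 2h, and neighbours y in V_(i+1)
    of the others with at least 4h neighbours in V_i, would lie on edges of
    codegree at least h, which is plenty.  So the triangles xyz may be taken with
    z in Z = {g(z) < 2h} and y in Y = {g(y) < 4h}.  Now vertices of Y are adjacent
    to all but 4h vertices of V_(i-1), whereas vertices of Z have few neighbours
    in Y: counting the edges between Y and Z shows |Z| <= 8h or |Y| <= 4h
    (poor_sets_small).  The triangles are thus confined to a small set in one
    of the classes, and the demand is met again.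

    Numerically, with p^(5 s (s+1)) of the order of n, one can take t of the
    order of n / p^5 and h of the order of n / p^3: every comparison then holds
    with at least a factor p to spare (dense_enough_pow), which absorbs all
    constants. The minimum degree exceeds n by enough because C >= 2
    (excess_lower_bound). *)

Set Implicit Arguments.
Unset Strict Implicit.
Unset Printing Implicit Defensive.

(** * Double counting and power means *)

Local Open Scope nat_scope.

Lemma ffact_le_exp n k : n ^_ k <= n ^ k.
Proof.
elim: k n => [|k IH] n; first by rewrite ffactn0.
rewrite ffactnSr expnSr leq_mul //; exact: leq_subr.
Qed.

Lemma exp_le_ffact n k : (n - k) ^ k <= n ^_ k.
Proof.
elim: k n => [|k IH] n; first by rewrite ffactn0.
rewrite ffactnSr expnSr leq_mul //; last by rewrite leq_sub2l.
by apply: leq_trans (IH n); have [->|k0] := posnP k; rewrite ?expn0 ?leq_exp2r ?leq_sub2l.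
Qed.

Lemma sum_bin_common (T U : finType) (E : {set U}) (N : U -> {set T})
    (C : {set T}) s :
  \sum_(e in E) 'C(#|N e :&: C|, s) =
  \sum_(S : {set T} | (S \subset C) && (#|S| == s))
    #|[set e in E | S \subset N e]|.
Proof.
transitivity (\sum_(e in E)
    \sum_(S : {set T} | (S \subset C) && (#|S| == s)) (S \subset N e : nat)).
  apply: eq_bigr => e _; rewrite -cards_draws -sum1_card big_mkcond /=.
  rewrite [RHS]big_mkcond /=; apply: eq_bigr => S _.
  by rewrite inE subsetI andbC; case: (S \subset C); case: (#|S| == s);
    case: (S \subset N e).
rewrite exchange_big; apply: eq_bigr => S _ /=.
rewrite -sum1_card [RHS]big_mkcond [LHS]big_mkcond.
by apply: eq_bigr => e _; rewrite inE; case: (e \in E); case: (S \subset N e).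
Qed.

(** The double count of pairs (e, S) with S an s-subset of N(e), freed of
    binomial coefficients by (n - s)^s <= n^_s <= n^s: the truncated
    subtraction is the price for keeping only powers. *)
Lemma sum_exp_common (T U : finType) (E : {set U}) (N : U -> {set T})
    (C : {set T}) s m :
  (forall S : {set T}, S \subset C -> #|S| = s ->
     #|[set e in E | S \subset N e]| <= m) ->
  \sum_(e in E) (#|N e :&: C| - s) ^ s <= m * #|C| ^ s.
Proof.
move=> hm.
apply: (@leq_trans (\sum_(e in E) 'C(#|N e :&: C|, s) * s`!)).
  by apply: leq_sum => e _; rewrite bin_ffact exp_le_ffact.
apply: (@leq_trans (m * 'C(#|C|, s) * s`!)); last first.
  by rewrite -mulnA bin_ffact leq_mul2l ffact_le_exp orbT.
rewrite -big_distrl leq_mul2r sum_bin_common; apply/orP; right.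
apply: (@leq_trans (\sum_(S : {set T} | (S \subset C) && (#|S| == s)) m)).
  by apply: leq_sum => S /andP[SC /eqP cS]; apply: hm.
rewrite sum_nat_const mulnC leq_mul2l -cards_draws; apply/orP; right.
by apply: eq_leq; apply: eq_card => S; rewrite inE.
Qed.

(** The rearrangement inequality for the pairs (a, b) and (a^k, b^k). *)
Lemma mul_exp_rearrange a b k : a * b ^ k + b * a ^ k <= a ^ k.+1 + b ^ k.+1.
Proof.
wlog ab : a b / a <= b.
  by move=> H; case: (leqP a b) => [/H//|/ltnW /H]; rewrite addnC [X in _ <= X]addnC.
have : a ^ k <= b ^ k by have [->|k0] := posnP k; rewrite ?expn0 ?leq_exp2r.
by rewrite !expnS; move: (a ^ k) (b ^ k) => u v; nia.
Qed.

(** Chebyshev's sum inequality, by adding the rearrangement inequalities of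
    all pairs of indices. *)
Lemma sum_mul_sum_exp (I : finType) (A : {set I}) (d : I -> nat) k :
  (\sum_(x in A) d x) * (\sum_(x in A) d x ^ k) <= #|A| * \sum_(x in A) d x ^ k.+1.
Proof.
have e1 : (\sum_(x in A) d x) * (\sum_(x in A) d x ^ k) =
    \sum_(x in A) \sum_(y in A) d x * d y ^ k.
  by rewrite big_distrl; apply: eq_bigr => x _; rewrite big_distrr.
have e2 : \sum_(x in A) \sum_(y in A) d x * d y ^ k =
    \sum_(x in A) \sum_(y in A) d y * d x ^ k by rewrite exchange_big.
have e3 : #|A| * \sum_(x in A) d x ^ k.+1 =
    \sum_(x in A) \sum_(y in A) d y ^ k.+1 by rewrite sum_nat_const.
have e4 : \sum_(x in A) \sum_(y in A) d y ^ k.+1 =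
    \sum_(x in A) \sum_(y in A) d x ^ k.+1 by rewrite exchange_big.
rewrite -(leq_pmul2l (m := 2)) // !mul2n -!addnn {1}e1 e1 {2}e2 e3 {2}e4.
rewrite -!big_split /=; apply: leq_sum => x _; rewrite -!big_split /=.
by apply: leq_sum => y _; rewrite [X in _ <= X]addnC mul_exp_rearrange.
Qed.

Lemma power_mean (I : finType) (A : {set I}) (d : I -> nat) k :
  (\sum_(x in A) d x) ^ k.+1 <= #|A| ^ k * \sum_(x in A) d x ^ k.+1.
Proof.
elim: k => [|k IH]; first by rewrite expn1 mul1n.
rewrite expnS; apply: leq_trans (leq_mul (leqnn _) IH) _.
rewrite mulnCA expnSr -mulnA leq_mul2l; apply/orP; right.
exact: sum_mul_sum_exp.
Qed.

Lemma card_pairs (T U : finType) (A : {set T}) (N : T -> {set U}) :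
  #|[set e : T * U | (e.1 \in A) && (e.2 \in N e.1)]| = \sum_(x in A) #|N x|.
Proof.
rewrite -sum1_card.
transitivity (\sum_(x in A) \sum_(z in N x) 1).
  by rewrite pair_big_dep; apply: eq_bigl => -[x z]; rewrite inE.
by apply: eq_bigr => x _; rewrite sum1_card.
Qed.

(** * Finding K_3(s) among edges of large codegree *)

Definition nbr (G : sgraph) (x : G) : {set G} := [set y | edge x y].

Lemma K3_of_sets (G : sgraph) s (W : 'I_3 -> {set G}) :
  (forall i, s <= #|W i|) ->
  (forall i j x y, i != j -> x \in W i -> y \in W j -> edge x y) ->
  contains_copy G (K3 s).
Proof.
move=> hs hW.
pose f (x : K3 s) : G := enum_val (widen_ord (hs x.1) x.2).
have fW x : f x \in W x.1 by apply: enum_valP.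
have fE (x y : K3 s) : edge x y -> edge (f x) (f y) by move=> xy; apply: hW xy _ _.
exists f => // -[i k] [j l] eqf.
have ij : i = j.
  apply/eqP/negP => /negP ij; have := @fE (i, k) (j, l) ij.
  by rewrite eqf edge_irr.
move: eqf; rewrite /f -{}ij /= => /enum_val_inj /(congr1 val) /= kl.
by congr (_, _); apply: val_inj.
Qed.

Lemma K3_of_three (G : sgraph) s (A B C : {set G}) :
  s <= #|A| -> s <= #|B| -> s <= #|C| ->
  (forall x y, x \in A -> y \in B -> edge x y) ->
  (forall x y, x \in A -> y \in C -> edge x y) ->
  (forall x y, x \in B -> y \in C -> edge x y) ->
  contains_copy G (K3 s).
Proof.
move=> sA sB sC AB AC BC.
apply: (@K3_of_sets G s (fun i : 'I_3 => nth set0 [:: A; B; C] i)).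
  by move=> [[|[|[|i]]] hi].
move=> [[|[|[|i]]] hi] [[|[|[|j]]] hj] x y //= _ hx hy;
  by [apply: AB|apply: AC|apply: BC|rewrite edge_sym; apply: AB
     |rewrite edge_sym; apply: AC|rewrite edge_sym; apply: BC].
Qed.

Definition rich_nbrs (G : sgraph) (B C : {set G}) g (x : G) : {set G} :=
  [set z in B | edge x z && (g <= #|nbr x :&: nbr z :&: C|)].

(** The second inequality is the density condition
    a (d/b)^s ((g-s)/c)^(s^2) > 2^s s; the first one makes the average degree
    of the graph left by averaging at least 2s, so that replacing degrees D by
    D - s costs a factor 2 only. *)
Definition dense_enough s a d g b c :=
  (2 * s * c ^ s < d * (g - s) ^ s) &&
  (2 ^ s * s * b ^ s * c ^ (s * s) < a * d ^ s * (g - s) ^ (s * s)).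

(** The pairs (x, z) are averaged over the s-subsets S of C first, and the
    vertices x over the s-subsets T of B afterwards. In this order the average
    codegree condition enters with exponent s^2 and the degree condition with
    exponent s only, which the numerical choices below depend on. *)
Lemma K3_of_rich (G : sgraph) s (A B C : {set G}) a d g b c :
  0 < s -> 0 < c -> a <= #|A| -> #|B| <= b -> #|C| <= c ->
  (forall x, x \in A -> d <= #|rich_nbrs B C g x|) ->
  dense_enough s a d g b c ->
  contains_copy G (K3 s).
Proof.
move=> s0 c0 aA Bb Cc hd /andP[h1 h2].
pose H (S : {set G}) x := [set z in rich_nbrs B C g x | S \subset nbr x :&: nbr z].
have sH S x : H S x \subset B.
  by apply/subsetP => z; rewrite !inE => /andP[/andP[]].
have [|noK] := boolP [exists S : {set G}, exists T : {set G},
    [&& S \subset C, #|S| == s, T \subset B, #|T| == s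
      & s <= #|[set x in A | T \subset H S x]|]].
  case/existsP => S /existsP[T /and5P[SC /eqP cS TB /eqP cT cA]].
  apply: (@K3_of_three G s _ T S cA); rewrite ?cS ?cT //.
  - by move=> x z; rewrite inE => /andP[_ /subsetP TH] /TH; rewrite !inE
      => /andP[/andP[_ /andP[]]].
  - move=> x y; rewrite inE => /andP[_ /subsetP TH] yS.
    have /card_gt0P[z /TH] : 0 < #|T| by rewrite cT.
    by rewrite inE => /andP[_ /subsetP/(_ y yS)]; rewrite !inE => /andP[].
  - move=> z y zT yS.
    have /card_gt0P[x] : 0 < #|[set x in A | T \subset H S x]|.
      exact: leq_trans cA.
    rewrite inE => /andP[_ /subsetP/(_ z zT)]; rewrite inE => /andP[_].
    by move/subsetP/(_ y yS); rewrite !inE => /andP[].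
exfalso.
have A0 : 0 < #|A| by apply: leq_trans aA; case: (a) h2.
(* The bipartite graph H S of a fixed S has no K_(s,s), hence few edges. *)
have eS (S : {set G}) : S \subset C -> #|S| = s ->
    (\sum_(x in A) #|H S x|) * c ^ s < #|A| * d * (g - s) ^ s.
  move=> SC cS; rewrite ltnNge; apply/negP => big.
  set e := \sum_(x in A) #|H S x| in big.
  have kst : (e - #|A| * s) ^ s <= #|A| ^ s.-1 * (s * b ^ s).
    have e1 : e - #|A| * s <= \sum_(x in A) (#|H S x :&: B| - s).
      rewrite leq_subLR -sum_nat_const -big_split /=; apply: leq_sum => x _.
      by rewrite (setIidPl (sH S x)) -leq_subLR.
    have [k sk] : exists k, s = k.+1 by exists s.-1; rewrite prednK.
    apply: (@leq_trans ((\sum_(x in A) (#|H S x :&: B| - s)) ^ s)).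
      by rewrite leq_exp2r.
    rewrite {2 3}sk; apply: leq_trans (power_mean _ _ _) _ => /=.
    rewrite leq_mul2l; apply/orP; right; rewrite -sk.
    apply: leq_trans (sum_exp_common (m := s) _) _; last first.
      by rewrite leq_mul2l leq_exp2r // Bb orbT.
    move=> T TB cT; rewrite leqNgt; apply/negP => cA.
    move/negP: noK; apply; apply/existsP; exists S; apply/existsP; exists T.
    by rewrite SC TB cS cT !eqxx ltnW.
  (* If the average degree e / |A| is at most 2s, the first density inequality
     fails; otherwise e - |A| s is at least e / 2 and the second one fails. *)
  have [e2|e2] := leqP e (2 * (#|A| * s)).
    have : #|A| * (2 * s * c ^ s) < #|A| * (2 * s * c ^ s).
      apply: (@leq_trans (#|A| * (d * (g - s) ^ s))); first by rewrite ltn_pmul2l.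
      rewrite mulnA; apply: leq_trans big _.
      by rewrite mulnA leq_mul2r; apply/orP; right; rewrite mulnCA mulnA in e2 *.
    by rewrite ltnn.
  have e3 : e <= 2 * (e - #|A| * s) by lia.
  have e4 : e ^ s <= 2 ^ s * (#|A| ^ s.-1 * (s * b ^ s)).
    apply: leq_trans (_ : (2 * (e - #|A| * s)) ^ s <= _); first by rewrite leq_exp2r.
    by rewrite expnMn leq_mul2l kst orbT.
  have e5 : (#|A| * d * (g - s) ^ s) ^ s <=
      2 ^ s * (#|A| ^ s.-1 * (s * b ^ s)) * c ^ (s * s).
    apply: (@leq_trans ((e * c ^ s) ^ s)); first by rewrite leq_exp2r.
    by rewrite expnMn -expnM leq_mul2r e4 orbT.
  suff : #|A| ^ s.-1 * (#|A| * d ^ s * (g - s) ^ (s * s)) <=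
         #|A| ^ s.-1 * (2 ^ s * s * b ^ s * c ^ (s * s)).
    rewrite leq_pmul2l ?expn_gt0 ?A0 // leqNgt => /negP; apply.
    by apply: leq_trans h2 _; rewrite !leq_mul2r aA !orbT.
  move: e5; rewrite 2!expnMn -expnM -[in #|A| ^ s](prednK s0) expnS; lia.
pose E := [set e : G * G | (e.1 \in A) && (e.2 \in rich_nbrs B C g e.1)].
have cE : #|A| * d <= #|E|.
  by rewrite card_pairs -sum_nat_const; apply: leq_sum.
have pos : 0 < #|A| * d * (g - s) ^ s.
  rewrite -mulnA muln_gt0 A0 /=; exact: leq_ltn_trans h1.
set D := #|A| * d * (g - s) ^ s in eS pos.
have mS (S : {set G}) : S \subset C -> #|S| = s ->
    #|[set e in E | S \subset nbr e.1 :&: nbr e.2]| <= D.-1 %/ c ^ s.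
  move=> SC cS; rewrite leq_divRL ?expn_gt0 ?c0 // -ltnS prednK //.
  apply: leq_trans (eS S SC cS); rewrite ltnS leq_mul2r; apply/orP; right.
  rewrite -card_pairs; apply/subset_leq_card/subsetP.
  by move=> e; rewrite !inE => /andP[/andP[-> /andP[-> ->]] ->].
have := sum_exp_common mS.
rewrite leqNgt => /negP; case.
apply: (@leq_ltn_trans (D.-1 %/ c ^ s * c ^ s)).
  by rewrite leq_mul2l leq_exp2r // Cc orbT.
apply: (@leq_ltn_trans D.-1); first exact: leq_divM.
rewrite prednK //; apply: (@leq_trans (#|E| * (g - s) ^ s)).
  by rewrite leq_mul2r cE orbT.
rewrite -sum_nat_const; apply: leq_sum => e; rewrite !inE => /andP[_ /andP[_ /andP[_ ge]]].
by rewrite leq_exp2r // leq_sub2r.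
Qed.

(** * Cyclic degrees in tripartite graphs *)

Definition next (i : 'I_3) : 'I_3 := (i + 1)%R.
Definition prev (i : 'I_3) : 'I_3 := (i - 1)%R.

Lemma prevK : cancel prev next. Proof. exact: subrK. Qed.
Lemma nextK : cancel next prev. Proof. exact: addrK. Qed.
Lemma prev_prev i : prev (prev i) = next i.
Proof. by case: i => [[|[|[|i]]] hi] //; apply: val_inj. Qed.
Lemma next_next i : next (next i) = prev i.
Proof. by rewrite -prev_prev !nextK. Qed.

Definition deg_to (G : sgraph) (V : 'I_3 -> {set G}) j (x : G) := #|nbr x :&: V j|.

(** The classes are ordered cyclically so that, for adjacent x in V_i and z in
    V_(i-1), the degree of x counted in V_(i+1) is its forward degree and that
    of z its backward degree: this makes forward degrees comparable along edges. *)
Definition cyclic_degree (G : sgraph) (V : 'I_3 -> {set G}) n t :=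
  (forall i, #|V i| = n) /\
  forall i x, x \in V i -> n + t <= deg_to V (next i) x + deg_to V (prev i) x.

Lemma min_degree_le (G : sgraph) (x : G) : min_degree G <= degree x.
Proof.
rewrite /min_degree; have := mem_index_enum x.
elim: (index_enum G) => // y l IH; rewrite big_cons inE geq_min => /orP[/eqP->|/IH->].
  by rewrite leqnn.
by rewrite orbT.
Qed.

Lemma cyclic_degree_balanced (G : sgraph) n t : balanced_tripartite n G ->
  n + t <= min_degree G -> exists V : 'I_3 -> {set G}, cyclic_degree V n t.
Proof.
case=> V [cov dis cV ind] hmin; exists V; split=> // i x xi.
apply: leq_trans hmin _; apply: leq_trans (min_degree_le x) _.
apply: leq_trans (leq_card_setU _ _); apply/subset_leq_card/subsetP => y.
rewrite !inE => xy; rewrite xy /=.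
have : y \in \bigcup_(i < 3) V i by rewrite cov inE.
case/bigcupP => j _ yj.
have [|ji] : (j == next i) || (j == prev i) \/ j = i.
- case: i j {xi yj} => [[|[|[|i]]] hi] [[|[|[|j]]] hj] //;
    by [left|right; apply: val_inj].
- by case/orP => /eqP <-; rewrite yj ?orbT.
- by have := ind _ _ _ xi (_ : y \in V i); rewrite xy -ji => /(_ yj).
Qed.

Lemma codegree_ge (G : sgraph) (V : 'I_3 -> {set G}) k x z :
  deg_to V k x + deg_to V k z <= #|V k| + #|nbr x :&: nbr z :&: V k|.
Proof.
rewrite /deg_to -cardsUI leq_add //.
  by rewrite subset_leq_card // subUset !subsetIr.
apply/subset_leq_card/subsetP => y.
by rewrite !inE => /andP[/andP[-> ->] /andP[-> _]].
Qed.

Definition top (G : sgraph) (V : 'I_3 -> {set G}) tau i : {set G} :=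
  [set x in V i | tau <= deg_to V (next i) x].

(** The level tau is the largest one at which some class still has m vertices;
    level 0 qualifies since m <= n. *)
Lemma top_level (G : sgraph) (V : 'I_3 -> {set G}) n m :
  (forall i, #|V i| = n) -> 0 < m <= n ->
  exists tau i, m <= #|top V tau i| /\ forall sigma j, tau < sigma -> #|top V sigma j| < m.
Proof.
move=> cV /andP[m0 mn].
have ex : exists tau, [exists i, m <= #|top V tau i|].
  exists 0; apply/existsP; exists ord0; rewrite -(cV ord0) in mn.
  by apply: leq_trans mn _; apply/subset_leq_card/subsetP => x; rewrite inE => ->.
have bnd tau : [exists i, m <= #|top V tau i|] -> tau <= n.
  case/existsP => i mi; have /card_gt0P[x] := leq_trans m0 mi.
  rewrite inE => /andP[_ ht]; apply: leq_trans ht _.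
  by rewrite -(cV (next i)) subset_leq_card // subsetIr.
case: (ex_maxnP ex bnd) => tau /existsP[i mi] tmax; exists tau, i; split=> // sigma j.
rewrite !ltnNge; apply: contra => mj; apply: tmax; apply/existsP; by exists j.
Qed.

(** A neighbour z of x is either above level tau, which fewer than m vertices
    are, or satisfies f(z) <= tau <= f(x), and then the edge xz has at least
    f(x) + (n + t - f(z)) - n >= t common neighbours. *)
Lemma top_level_rich (G : sgraph) (V : 'I_3 -> {set G}) n t m tau i x :
  cyclic_degree V n t ->
  (forall sigma j, tau < sigma -> #|top V sigma j| < m) ->
  x \in top V tau i ->
  deg_to V (prev i) x < #|rich_nbrs (V (prev i)) (V (next i)) t x| + m.
Proof.
move=> [cV dV] low; rewrite inE => /andP[xi tx].
have := low tau.+1 (prev i) (ltnSn _); rewrite -(ltn_add2l #|rich_nbrs (V (prev i)) (V (next i)) t x|).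
apply: leq_ltn_trans; apply: leq_trans (leq_card_setU _ _).
apply/subset_leq_card/subsetP => z; rewrite !inE => /andP[xz zp]; rewrite xz zp /=.
rewrite prevK.
have [//|zt] /= := leqP t #|nbr x :&: nbr z :&: V (next i)|; rewrite ltnNge; apply/negP => fz.
have := dV _ _ zp; rewrite prevK prev_prev => dz.
have := codegree_ge V (next i) x z; rewrite cV; lia.
Qed.

(** At level m = 2u, half of the top vertices have f < n - 4u, since the others
    are at most 4r <= u; those have g > 8r + 4u, of which at most 2u neighbours
    are lost. *)
Lemma K3_of_no_top (G : sgraph) (V : 'I_3 -> {set G}) n s r u :
  0 < s -> 0 < r -> 4 * r <= u -> 4 * u <= n ->
  cyclic_degree V n (8 * r) ->
  (forall j, #|top V (n - 4 * u) j| < 4 * r) ->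
  dense_enough s u u r n n ->
  contains_copy G (K3 s).
Proof.
move=> s0 r0 ru un cyc low de; have [cV dV] := cyc.
have [|tau [i [big lowt]]] := @top_level G V n (2 * u) cV; first lia.
have tn : tau < n - 4 * u.
  rewrite ltnNge; apply/negP => le; have := low i; apply/negP; rewrite -leqNgt.
  apply: leq_trans (_ : #|top V tau i| <= _); first lia.
  apply/subset_leq_card/subsetP => x; rewrite !inE => /andP[-> h]; exact: leq_trans h.
apply: (@K3_of_rich G s (top V tau i :\: top V (n - 4 * u) i)
  (V (prev i)) (V (next i)) u u r n n) => //; rewrite ?cV //; first lia.
  have := cardsID (top V (n - 4 * u) i) (top V tau i).
  have : #|top V tau i :&: top V (n - 4 * u) i| <= #|top V (n - 4 * u) i|.
    by rewrite subset_leq_card // subsetIr.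
  have := low i; lia.
move=> x; rewrite inE => /andP[xnot xt].
have := top_level_rich cyc lowt xt.
have [xi fx] : x \in V i /\ deg_to V (next i) x < n - 4 * u.
  move: xnot xt; rewrite !inE => nx /andP[xi _]; split=> //.
  by rewrite ltnNge; apply: contra nx => h; rewrite xi.
have := dV _ _ xi => dx.
have : #|rich_nbrs (V (prev i)) (V (next i)) (8 * r) x| <=
       #|rich_nbrs (V (prev i)) (V (next i)) r x|.
  apply/subset_leq_card/subsetP => z; rewrite !inE => /andP[-> /andP[-> h]] /=.
  by apply: leq_trans h; lia.
lia.
Qed.

Lemma card_edges_sym (G : sgraph) (Y Z : {set G}) :
  \sum_(y in Y) #|nbr y :&: Z| = \sum_(z in Z) #|nbr z :&: Y|.
Proof.
transitivity (\sum_(y in Y) \sum_(z in Z) (edge y z : nat)).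
  apply: eq_bigr => y _; rewrite -sum1_card big_mkcond [RHS]big_mkcond.
  by apply: eq_bigr => z _; rewrite !inE; case: edge; case: (z \in Z).
rewrite exchange_big; apply: eq_bigr => z _.
rewrite -sum1_card big_mkcond [RHS]big_mkcond.
by apply: eq_bigr => y _; rewrite !inE edge_sym; case: edge; case: (y \in Y).
Qed.

Definition poor (G : sgraph) (V : 'I_3 -> {set G}) j k b : {set G} :=
  [set z in V j | deg_to V k z < b].

(** If |Z| > 8h then each y in Y, missing at most 4h vertices of the class of Z,
    is adjacent to more than half of Z, while each z in Z has at most 2h
    neighbours in Y; so half of |Y| is at most 2h. *)
Lemma poor_sets_small (G : sgraph) (V : 'I_3 -> {set G}) n t i h :
  cyclic_degree V n t ->
  (#|poor V (prev i) (next i) (2 * h)| <= 8 * h) ||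
  (#|poor V (next i) i (4 * h)| <= 4 * h).
Proof.
move=> [cV dV]; set Z := poor V (prev i) _ _; set Y := poor V (next i) _ _.
have [//|bigZ] /= := leqP #|Z| (8 * h).
have up : \sum_(z in Z) #|nbr z :&: Y| <= #|Z| * (2 * h).
  rewrite -sum_nat_const; apply: leq_sum => z; rewrite inE => /andP[_ zl].
  apply: leq_trans (ltnW zl); apply: subset_leq_card; apply: setIS.
  by apply/subsetP => y; rewrite inE => /andP[].
have dn : #|Y| * (#|Z| - 4 * h) <= \sum_(y in Y) #|nbr y :&: Z|.
  rewrite -sum_nat_const; apply: leq_sum => y; rewrite inE => /andP[yn yl].
  have := dV _ _ yn; rewrite nextK next_next => dy.
  have ZV : Z \subset V (prev i) by apply/subsetP => z; rewrite inE => /andP[].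
  have := cardsUI (nbr y :&: V (prev i)) Z.
  have -> : nbr y :&: V (prev i) :&: Z = nbr y :&: Z by rewrite -setIA (setIidPr ZV).
  have : #|nbr y :&: V (prev i) :|: Z| <= n.
    by rewrite -(cV (prev i)) subset_leq_card // subUset subsetIr.
  rewrite -[#|nbr y :&: V (prev i)|]/(deg_to V (prev i) y); lia.
rewrite card_edges_sym in dn; rewrite leqNgt; apply/negP => bigY.
have := leq_trans dn up; nia.
Qed.

Lemma card_split_lt (T : finType) (A : {set T}) (P : pred T) a b :
  a + b <= #|A| -> #|[set x in A | P x]| < a -> b < #|[set x in A | ~~ P x]|.
Proof.
have -> : [set x in A | ~~ P x] = A :\: [set x | P x].
  by apply/setP => x; rewrite !inE andbC.
have -> : [set x in A | P x] = A :&: [set x | P x].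
  by apply/setP => x; rewrite !inE.
by have := cardsID [set x | P x] A; lia.
Qed.

(** The case of about t vertices with f >= n - h, where t = 8r and h = 4u. Each
    of the three density hypotheses serves one way in which the triangles on
    these vertices can be arranged: on edges of codegree at least u, inside a
    small part of V_(i-1), or inside a small part of V_(i+1). *)
Lemma K3_of_top (G : sgraph) (V : 'I_3 -> {set G}) n s r u i tau :
  0 < s -> 0 < r -> 4 * r <= u -> 16 * u <= n ->
  cyclic_degree V n (8 * r) -> n - 4 * u <= tau ->
  4 * r <= #|top V tau i| ->
  (forall sigma j, tau < sigma -> #|top V sigma j| < 4 * r) ->
  dense_enough s r r u n n ->
  dense_enough s r r r (32 * u) n ->
  dense_enough s r r r n (16 * u) ->
  contains_copy G (K3 s).
Proof.
move=> s0 r0 ru un cyc taun big low de1 de2 de3; have [cV dV] := cyc.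
have n0 : 0 < n by lia.
set X := top V tau i in big.
pose R x := rich_nbrs (V (prev i)) (V (next i)) (8 * r) x.
pose Z := poor V (prev i) (next i) (2 * (4 * u)).
pose Y := poor V (next i) i (4 * (4 * u)).
have Xi x : x \in X -> x \in V i /\ n - 4 * u <= deg_to V (next i) x.
  by rewrite inE => /andP[-> h]; split=> //; apply: leq_trans h.
have RX x : x \in X -> 4 * r <= #|R x|.
  move=> xX; have := top_level_rich cyc low xX.
  have [xi _] := Xi _ xX; have := dV _ _ xi.
  have : deg_to V (next i) x <= n by rewrite -(cV (next i)) subset_leq_card // subsetIr.
  rewrite /R; lia.
(* An edge from X to a vertex outside Z has at least
   (n - 4u) + 8u - n = 4u common neighbours. *)
have [X1big|X1small] := leqP (2 * r) #|[set x in X | 2 * r <= #|R x :\: Z|]|.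
  apply: (@K3_of_rich G s [set x in X | 2 * r <= #|R x :\: Z|]
    (V (prev i)) (V (next i)) r r u n n) => //; rewrite ?cV //; first lia.
  move=> x; rewrite inE => /andP[xX hx].
  apply: leq_trans (_ : #|R x :\: Z| <= _); first lia.
  apply/subset_leq_card/subsetP => z; rewrite !inE => /andP[zZ /andP[zp /andP[xz _]]].
  rewrite zp xz /=; rewrite zp /= -leqNgt in zZ.
  have [_ fx] := Xi _ xX; have := codegree_ge V (next i) x z; rewrite cV; lia.
have XX : 2 * r + 2 * r <= #|X| by lia.
have X2big := card_split_lt XX X1small.
set X2 := [set x in X | _] in X2big.
have RZ x : x \in X2 -> 2 * r < #|R x :&: Z|.
  rewrite inE -ltnNge => /andP[xX hx]; have := RX _ xX.
  have := cardsID Z (R x); lia.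
(* Vertices of Zb have f >= n - 8u, so an edge from Zb to a vertex outside Y
   has at least (n - 8u) + 16u - n = 8u common neighbours. *)
pose Zb := [set z in Z | 4 * r <= #|nbr z :&: V (next i) :\: Y|].
have [Zbig|Zsmall] := leqP r #|Zb|.
  apply: (@K3_of_rich G s Zb (V (next i)) (V i) r r u n n) => //; rewrite ?cV //.
  move=> z; rewrite !inE => /andP[/andP[zp zl] hz].
  apply: leq_trans (_ : #|nbr z :&: V (next i) :\: Y| <= _); first lia.
  apply/subset_leq_card/subsetP => y; rewrite !inE => /andP[yY /andP[zy yn]].
  rewrite yn zy /=; rewrite yn /= -leqNgt in yY.
  have := dV _ _ zp; rewrite prevK prev_prev => dz.
  have := codegree_ge V i z y; rewrite cV; lia.
have RY x : x \in X2 -> r <= #|rich_nbrs Z Y r x|.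
  move=> xX; apply: leq_trans (_ : #|(R x :&: Z) :\: Zb| <= _).
    have := RZ _ xX; have := cardsID Zb (R x :&: Z).
    have : #|R x :&: Z :&: Zb| <= #|Zb| by rewrite subset_leq_card // subsetIr.
    lia.
  apply/subset_leq_card/subsetP => z; rewrite !inE.
  case/andP=> zb /andP[/andP[zp /andP[xz cz]] /andP[_ zl]].
  rewrite zp zl xz /= in zb *; rewrite -ltnNge in zb.
  have := cardsID Y (nbr x :&: nbr z :&: V (next i)).
  have : #|nbr x :&: nbr z :&: V (next i) :\: Y| <= #|nbr z :&: V (next i) :\: Y|.
    by rewrite subset_leq_card // setSD // -setIA subsetIr.
  have : #|nbr x :&: nbr z :&: V (next i) :&: Y| <= #|nbr x :&: nbr z :&: Y|.
    by rewrite subset_leq_card // setSI // subsetIl.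
  lia.
have card_poor j k b : #|poor V j k b| <= n.
  by rewrite -(cV j) subset_leq_card //; apply/subsetP => z; rewrite inE => /andP[].
have X2r : r <= #|X2| by lia.
case/orP: (poor_sets_small i (4 * u) cyc).
- move=> cZ; apply: (@K3_of_rich G s X2 Z Y r r r (32 * u) n) => //; last exact: card_poor.
  by apply: leq_trans cZ _; lia.
- move=> cY; apply: (@K3_of_rich G s X2 Z Y r r r n (16 * u)) => //; first lia.
    exact: card_poor.
  by apply: leq_trans cY _; lia.
Qed.

Lemma K3_of_cyclic_degree (G : sgraph) (V : 'I_3 -> {set G}) n s r u :
  0 < s -> 0 < r -> 4 * r <= u -> 16 * u <= n ->
  cyclic_degree V n (8 * r) ->
  dense_enough s u u r n n ->
  dense_enough s r r u n n ->
  dense_enough s r r r (32 * u) n ->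
  dense_enough s r r r n (16 * u) ->
  contains_copy G (K3 s).
Proof.
move=> s0 r0 ru un cyc de0 de1 de2 de3; have [cV dV] := cyc.
have [|tau [i [big low]]] := @top_level G V n (4 * r) cV; first lia.
have [le|lt] := leqP (n - 4 * u) tau; first exact: (K3_of_top _ _ _ _ cyc le big low).
by apply: (@K3_of_no_top G V n s r u) => //; [lia | move=> j; apply: low].
Qed.

(** * Numerical choices *)

Lemma pow_lt_contra E K M p n e f :
  0 < p -> p ^ E <= K * n -> n * p ^ f <= M * p ^ e -> e < E + f -> p <= K * M.
Proof.
move=> p0 hE h ef; have pe : 0 < p ^ e by rewrite expn_gt0 p0.
rewrite -(leq_pmul2r pe) -expnS; apply: leq_trans (_ : p ^ (E + f) <= _).
  by rewrite leq_pexp2l.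
rewrite expnD; apply: leq_trans (leq_mul hE (leqnn _)) _.
by rewrite -!mulnA leq_mul2l h orbT.
Qed.

(** All quantities are measured in powers of p relative to n: a, d, g - s are at
    least n / p^ea, n / p^ed, n / p^eg and b, c at most n / p^eb, n / p^ec, up to
    the constant Q, while n is at least p^E / K. The density inequalities then
    compare exponents of p, and a strict comparison leaves a factor p that
    absorbs every constant. *)
Lemma dense_enough_pow s E K Q p n a d g b c ea ed eg eb ec :
  0 < s -> 0 < n -> 0 < Q -> p ^ E <= K * n ->
  n <= Q * a * p ^ ea -> n <= Q * d * p ^ ed -> n <= Q * (g - s) * p ^ eg ->
  b * p ^ eb <= Q * n -> c * p ^ ec <= Q * n ->
  ed + s * eg < E + s * ec ->
  ea + s * ed + s * s * eg < E + (s * eb + s * s * ec) ->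
  K * (2 ^ s * s * Q ^ (1 + 2 * s + 2 * (s * s))) < p ->
  dense_enough s a d g b c.
Proof.
move=> s0 n0 Q0 hE; set h := g - s => ha hd hh hb hc e1 e2 big.
have p0 : 0 < p by apply: leq_ltn_trans big.
have mono k x y : x <= y -> x ^ k <= y ^ k.
  by move=> xy; have [->|k0] := posnP k; rewrite ?expn0 ?leq_exp2r.
rewrite /dense_enough -/h; apply/andP; split; rewrite ltnNge; apply/negP => le;
  move: big; apply/negP; rewrite -leqNgt.
- have : p <= K * (2 * s * Q ^ (1 + 2 * s)).
    apply: (pow_lt_contra p0 hE _ e1).
    have ns : 0 < n ^ s by rewrite expn_gt0 n0.
    rewrite -(leq_pmul2r ns).
    have : n * n ^ s <= Q * d * p ^ ed * (Q * h * p ^ eg) ^ s by rewrite leq_mul ?mono.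
    have := mono s _ _ hc; rewrite !expnMn -!expnM [ec * s]mulnC [eg * s]mulnC => A B.
    have -> : n * p ^ (s * ec) * n ^ s = n * n ^ s * p ^ (s * ec) by lia.
    apply: leq_trans (leq_mul B (leqnn _)) _.
    apply: (@leq_trans (Q * Q ^ s * p ^ ed * p ^ (s * eg) * (2 * s) * (c ^ s * p ^ (s * ec)))).
      have := leq_mul (leqnn (Q * Q ^ s * p ^ ed * p ^ (s * eg) * p ^ (s * ec))) le; lia.
    apply: leq_trans (leq_mul (leqnn _) A) _.
    rewrite add1n expnS mul2n -addnn !expnD; lia.
  move=> h1; apply: leq_trans h1 _; rewrite leq_mul2l; apply/orP; right.
  apply: leq_mul; last by rewrite leq_pexp2l // leq_addr.
  by rewrite leq_mul2r; apply/orP; right; rewrite -{1}(expn1 2) leq_pexp2l.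
- apply: (pow_lt_contra p0 hE _ e2).
  have ns : 0 < n ^ s * n ^ (s * s) by rewrite muln_gt0 !expn_gt0 n0.
  rewrite -(leq_pmul2r ns).
  have : n * n ^ s * n ^ (s * s) <=
      Q * a * p ^ ea * (Q * d * p ^ ed) ^ s * (Q * h * p ^ eg) ^ (s * s).
    by rewrite !leq_mul ?mono.
  have := mono s _ _ hb; have := mono (s * s) _ _ hc.
  rewrite !expnMn -!expnM [ec * _]mulnC [eg * _]mulnC [eb * _]mulnC [ed * _]mulnC => C B A.
  have -> : n * p ^ (s * eb + s * s * ec) * (n ^ s * n ^ (s * s)) =
     n * n ^ s * n ^ (s * s) * (p ^ (s * eb) * p ^ (s * s * ec)) by rewrite expnD; lia.
  apply: leq_trans (leq_mul A (leqnn _)) _.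
  apply: (@leq_trans (Q * Q ^ s * Q ^ (s * s) * (p ^ ea * p ^ (s * ed) * p ^ (s * s * eg)) *
     (2 ^ s * s) * ((b ^ s * p ^ (s * eb)) * (c ^ (s * s) * p ^ (s * s * ec))))).
    have := leq_mul (leqnn (Q * Q ^ s * Q ^ (s * s) *
      (p ^ ea * p ^ (s * ed) * p ^ (s * s * eg)) * (p ^ (s * eb) * p ^ (s * s * ec)))) le.
    lia.
  apply: leq_trans (leq_mul (leqnn _) (leq_mul B C)) _.
  rewrite add1n !expnD expnS !mul2n -!addnn !expnD; lia.
Qed.

Lemma scale_bounds s p n r u : 1 < s -> 4 < p -> 8 * s * p ^ 5 <= n ->
  r = n %/ (4 * p ^ 5) -> u = n %/ (4 * p ^ 3) ->
  [/\ 2 * s <= r, 4 * r <= u, 16 * u <= n &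
   [/\ n <= 32 * (r - s) * p ^ 5, n <= 32 * (u - s) * p ^ 3
     & 32 * u * p ^ 3 <= 32 * n]].
Proof.
move=> s1 p4 n5 rE uE.
have p5 : 0 < 4 * p ^ 5 by rewrite muln_gt0 expn_gt0; lia.
have p3 : 0 < 4 * p ^ 3 by rewrite muln_gt0 expn_gt0; lia.
have rn : r * (4 * p ^ 5) <= n by rewrite rE leq_divM.
have un : u * (4 * p ^ 3) <= n by rewrite uE leq_divM.
have rn' : n < r.+1 * (4 * p ^ 5) by rewrite rE ltn_ceil.
have un' : n < u.+1 * (4 * p ^ 3) by rewrite uE ltn_ceil.
have p53 : 4 * p ^ 3 <= p ^ 5.
  rewrite (expnD p 2 3) leq_mul2r; apply/orP; right.
  by apply: (@leq_mul 2 2); lia.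
have p34 : 4 <= p ^ 3 by apply: (@leq_trans (p ^ 1)); [lia|rewrite leq_pexp2l //; lia].
have rs : 2 * s <= r by rewrite rE leq_divRL //; lia.
have ru : 4 * r <= u.
  rewrite uE leq_divRL //; apply: leq_trans rn.
  by rewrite [4 * r]mulnC -mulnA leq_mul2l leq_mul2l p53 !orbT.
have bnd k a w : w.+1 <= 8 * a -> n < w.+1 * (4 * p ^ k) -> n <= 32 * a * p ^ k.
  move=> wa /ltnW/leq_trans; apply; rewrite mulnA leq_mul2r.
  by move: wa; clear; lia.
split=> //.
  apply: leq_trans un; rewrite mulnC leq_mul2l; apply/orP; right.
  by move: p34; clear; lia.
split; last by move: un; clear; lia.
  by apply: (bnd 5 _ r _ rn'); move: s1 rs; clear; lia.
by apply: (bnd 3 _ u _ un'); move: s1 rs ru; clear; lia.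
Qed.

(** With r of order n / p^5 and u of order n / p^3, the densities needed in
    K3_of_cyclic_degree leave spare powers p^(2s-3), p^(2s^2-5), p^(3s-5) and
    p^(3s^2-5) respectively, all at least p as s >= 2. *)
Lemma K3_of_degree_pow s K : 1 < s -> exists P, forall p n, P < p ->
  p ^ (5 * (s * s.+1)) <= K * n ->
  forall G : sgraph, balanced_tripartite n G ->
    n + 8 * (n %/ (4 * p ^ 5)) <= min_degree G ->
    contains_copy G (K3 s).
Proof.
move=> s1; set E := 5 * _.
pose P := K * (2 ^ s * s * 32 ^ (1 + 2 * s + 2 * (s * s))).
exists (P + (K * (8 * s) + 4)) => p n Pp hE G bal hdeg.
have Pp' : P < p by apply: leq_ltn_trans Pp; apply: leq_addr.
have {}Pp : K * (8 * s) + 4 < p by apply: leq_ltn_trans Pp; apply: leq_addl.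
have s0 : 0 < s by apply: ltnW.
have ss : 4 <= s * s by apply: (@leq_mul 2 2).
have p4 : 4 < p by apply: leq_ltn_trans Pp; apply: leq_addl.
have p0 : 0 < p by apply: leq_trans p4.
have n5 : 8 * s * p ^ 5 <= n.
  rewrite leqNgt; apply/negP => lt; have : p <= K * (8 * s).
    apply: (@pow_lt_contra E K (8 * s) p n 5 0) => //.
      by rewrite expn0 muln1 ltnW.
    by rewrite /E; move: s1 ss; clear; lia.
  by rewrite leqNgt => /negP; apply; apply: leq_ltn_trans Pp; apply: leq_addr.
set r := n %/ _ in hdeg; pose u := n %/ (4 * p ^ 3).
have [rs ru u16 [hrs hus h32]] := scale_bounds s1 p4 n5 (erefl r) (erefl u).
clearbody r u.
have r0 : 0 < r by move: s1 rs; clear; lia.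
have n0 : 0 < n by move: r0 ru u16; clear; lia.
have sub a k : n <= 32 * (a - s) * p ^ k -> n <= 32 * a * p ^ k.
  by move/leq_trans; apply; rewrite leq_mul2r leq_mul2l leq_subr !orbT.
have hr := sub _ _ hrs; have hu := sub _ _ hus.
have hn : n * p ^ 0 <= 32 * n by rewrite expn0 muln1 leq_pmull.
have h16 : 16 * u * p ^ 3 <= 32 * n.
  by apply: leq_trans h32; rewrite !leq_mul2r !orbT.
have [V cyc] := cyclic_degree_balanced bal hdeg.
apply: (@K3_of_cyclic_degree G V n s r u) => //.
- by apply: (@dense_enough_pow s E K 32 p n u u r n n 3 3 5 0 0) => //;
    rewrite /E; move: s1 ss; clear; lia.
- by apply: (@dense_enough_pow s E K 32 p n r r u n n 5 5 3 0 0) => //;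
    rewrite /E; move: s1 ss; clear; lia.
- by apply: (@dense_enough_pow s E K 32 p n r r r (32 * u) n 5 5 5 3 0) => //;
    rewrite /E; move: s1 ss; clear; lia.
- by apply: (@dense_enough_pow s E K 32 p n r r r n (16 * u) 5 5 5 0 3) => //;
    rewrite /E; move: s1 ss; clear; lia.
Qed.

Lemma root_bracket E n : 0 < E -> exists p, n <= p ^ E <= 2 ^ E * n.
Proof.
move=> E0; have ex : exists p, n <= p ^ E.
  by exists n; rewrite -{1}(expn1 n); case: n => // n; rewrite leq_pexp2l.
case: (ex_minnP ex) => p hp pmin; exists p; rewrite hp /=.
case: p hp pmin => [|[|p]] hp pmin; first by rewrite exp0n.
  case: n hp {ex} pmin => [|n] hp pmin; first by have := pmin 0 (leq0n _).
  by rewrite exp1n muln_gt0 expn_gt0.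
apply: (@leq_trans ((2 * p.+1) ^ E)); first by rewrite leq_exp2r //; lia.
rewrite expnMn leq_mul2l ltnW ?orbT // ltnNge; apply/negP => /pmin; lia.
Qed.

Local Open Scope ring_scope.

(** Here n^(1/(s(s+1))) <= p^5, so that C n^(1 - 1/(s(s+1))) >= 2 n / p^5. *)
Lemma excess_lower_bound (R : realType) (s n p : nat) (C : R) :
  (0 < s)%N -> (0 < n)%N -> (n <= p ^ (5 * (s * s.+1)))%N -> 2 <= C ->
  (8 * (n %/ (4 * p ^ 5)))%:R <= C * n%:R `^ (1 - 1 / (s%:R * (s%:R + 1))).
Proof.
move=> s0 n0 hn hC.
have p0 : (0 < p)%N by case: p hn => // /(leq_trans n0); rewrite exp0n // !muln_gt0 s0.
have nR : 0 < n%:R :> R by rewrite ltr0n.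
have pR : 0 < (p ^ 5)%:R :> R by rewrite ltr0n expn_gt0 p0.
set x : R := 1 / _.
have hx : n%:R `^ x <= (p ^ 5)%:R.
  have k0 : (s * s.+1)%:R != 0 :> R by rewrite pnatr_eq0 -lt0n muln_gt0 s0.
  have -> : x = (s * s.+1)%:R^-1 by rewrite /x div1r natrM -natr1.
  have -> : (p ^ 5)%:R = (((p ^ 5) ^ (s * s.+1))%:R : R) `^ (s * s.+1)%:R^-1.
    by rewrite (natrX _ (p ^ 5)) -powR_mulrn ?ler0n // -powRrM divff // powRr1 ?ler0n.
  by rewrite ge0_ler_powR ?nnegrE ?invr_ge0 ?ler0n // ler_nat -expnM.
have e : n%:R `^ (1 - x) = n%:R / n%:R `^ x :> R.
  have nz : (n%:R != 0 :> R) by rewrite gt_eqF.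
  rewrite powRD; last by rewrite nz implybT.
  by rewrite powRN powRr1 ?ler0n.
rewrite e; have nx : 0 < n%:R `^ x :> R by rewrite powR_gt0.
apply: (@le_trans _ _ (2 * (n%:R / (p ^ 5)%:R))); last first.
  apply: ler_pM => //; first by rewrite divr_ge0 // ltW.
  by rewrite ler_pM2l // lef_pV2.
rewrite mulrA ler_pdivlMr // -!natrM ler_nat -[X in (X <= _)%N]mulnA.
by have := leq_divM n (4 * p ^ 5); lia.
Qed.

Unset Implicit Arguments.

Theorem theorem1p4 (R : realType) :
  (forall s : nat, (2 <= s)%N ->
     let C : R := 2 * (s%:R - 1) `^ (1 / (s%:R + 1)) in
     exists n0 : nat, forall n : nat, (n0 <= n)%N ->
       forall G : sgraph, balanced_tripartite n G ->
         n%:R + C * n%:R `^ (1 - 1 / (s%:R * (s%:R + 1))) <= (min_degree G)%:R ->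
         contains_copy G (K3 s))
  /\
  (exists n0 : nat, forall n : nat, (n0 <= n)%N ->
     forall G : sgraph, balanced_tripartite n G ->
       n%:R + 2 * n%:R `^ (5 / 6) <= (min_degree G)%:R :> R ->
       contains_copy G (K3 2)).
Proof.
have main (s : nat) (C : R) : (2 <= s)%N -> 2 <= C ->
    exists n0 : nat, forall n : nat, (n0 <= n)%N ->
      forall G : sgraph, balanced_tripartite n G ->
        n%:R + C * n%:R `^ (1 - 1 / (s%:R * (s%:R + 1))) <= (min_degree G)%:R ->
        contains_copy G (K3 s).
  move=> s2 C2; set E := (5 * (s * s.+1))%N.
  have E0 : (0 < E)%N by rewrite !muln_gt0 /=; lia.
  have [P hP] := K3_of_degree_pow (2 ^ E) s2.
  exists (P ^ E).+1 => n nP G bal hdeg.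
  have [p /andP[np pn]] := root_bracket n E0.
  apply: (hP p n _ pn G bal); first by rewrite -(ltn_exp2r _ _ E0); apply: leq_trans np.
  rewrite -(ler_nat R) natrD; apply: le_trans hdeg; rewrite lerD2l.
  by apply: excess_lower_bound => //; lia.
split=> [s s2 C|].
  apply: main => //; rewrite /C -[X in X <= _]mulr1 ler_pM2l //.
  have s1 : 1 <= s%:R - 1 :> R by rewrite lerBrDr -(natrD _ 1 1) ler_nat.
  rewrite -[X in X <= _](powRr0 (s%:R - 1)) ler_powR // divr_ge0 //.
  by rewrite addr_ge0.
have [n0 h] := main 2 2 isT (lexx _); exists n0 => n nn G bal hdeg.
apply: (h n nn G bal); suff -> : 1 - 1 / (2%:R * (2%:R + 1)) = 5 / 6 :> R by [].
have -> : 2%:R * (2%:R + 1) = 6 :> R by lra.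
by lra.
Qed.
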